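(* Let $\mathfrak{R}$ be an elementary divisor domain that is not a field, with field of fractions $\mathbb{F}$. Let $A\in\mathfrak{R}^{n\times n}$, $B\in\mathfrak{R}^{n\times m}$, $C\in\mathfrak{R}^{p\times n}$ and $D\in\mathfrak{R}^{p\times m}$ with $\det A\neq 0$. Let $$P=\begin{bmatrix} A & B\\ C & D\end{bmatrix}\in\mathfrak{R}^{(n+p)\times (n+m)},\qquad G=D-CA^{-1}B\in\mathbb{F}^{p\times m},\qquad r=\operatorname{rank} G .$$ Assume that $A$ and $B$ are left coprime and that $A$ and $C$ are right coprime. 1. If the Smith-McMillan form of $G$ is $$S_G \doteq \operatorname{Diag}\left(\frac{\varepsilon_1}{\psi_1},\ldots, \frac{\varepsilon_r}{\psi_r}\right) \oplus 0_{(p-r) \times (m-r)},$$ and $g$ is the largest index in $\{1,\ldots ,r \}$ such that $\psi_g \notin \mathfrak{R}^\times$ (with $g=0$ if there is no such index), then (i) the Smith form of $P$ is $S_P \doteq I_n \oplus \operatorname{Diag}(\varepsilon_1,\ldots, \varepsilon_r ) \oplus 0_{(p-r) \times (m-r)}$, and (ii) the Smith form of $A$ is $S_A \doteq I_{n-g} \oplus \operatorname{Diag}( \psi_g,\ldots, \psi_1 )$ (in particular $n\ge g$). 2. Conversely, if the Smith forms of $A$ and $P$ are $S_A\doteq\operatorname{Diag}( \psi_n,\ldots, \psi_1 )\in\mathfrak{R}^{n\times n}$ and $S_P\doteq\operatorname{Diag}(\varepsilon_1,\ldots, \varepsilon_{n+r})\oplus 0_{(p-r) \times (m-r)}\in\mathfrak{R}^{(n+p)\times(n+m)}$,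 respectively, then (iii) $\varepsilon_1\doteq \cdots\doteq\varepsilon_n\doteq 1$; (iv) $\psi_n\doteq\cdots\doteq\psi_{r+1}\doteq 1$ if $n\geq r$; and (v) the Smith-McMillan form of $G$ is $$S_G\doteq \operatorname{Diag}\left(\frac{\varepsilon_{n+1}}{\psi_1},\ldots,\frac{\varepsilon_{n+r}}{\psi_r}\right) \oplus 0_{(p-r) \times (m-r)}\in\mathbb{F}^{p\times m},$$ where, if $r\geq n$, one sets $\psi_{n+1}\doteq\cdots\doteq\psi_r\doteq 1$.
   Context: An elementary divisor domain (EDD) is an integral domain $\mathfrak{R}$ such that every $a,b,c\in\mathfrak{R}$ have a greatest common divisor which can be written $\gcd(a,b,c)=zxa+zyb+wyc$ for some $x,y,z,w\in\mathfrak{R}$; equivalently, an integral domain over which every matrix has a Smith form (defined below). $\mathfrak{R}^\times$ is the group of units. A square matrix over $\mathfrak{R}$ is unimodular if it is invertible over $\mathfrak{R}$. Two matrices $M,N$ of the same size over $\mathbb{F}$ are equivalent if $UMV=N$ with $U,V$ unimodular over $\mathfrak{R}$. Rank is rank over $\mathbb{F}$. Smith form of $M\in\mathfrak{R}^{p\times m}$ of rank $r$: a matrix $\operatorname{Diag}(\alpha_1,\dots,\alpha_r)\oplus 0_{(p-r)\times(m-r)}$ equivalent to $M$ with all $\alpha_i\in\mathfrak R$ nonzero and $\alpha_1\mid\alpha_2\mid\cdots\mid\alpha_r$ (the $\alpha_i$ are the invariant factors, unique up to units). Smith-McMillan form of $G\in\mathbb{F}^{p\times m}$ of rank $r$: a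 matrix $\operatorname{Diag}(\varepsilon_1/\psi_1,\dots,\varepsilon_r/\psi_r)\oplus 0_{(p-r)\times(m-r)}$ equivalent to $G$, with nonzero $\varepsilon_i,\psi_i\in\mathfrak{R}$, $\varepsilon_1\mid\cdots\mid\varepsilon_r$, $\psi_r\mid\cdots\mid\psi_1$ and $\gcd(\varepsilon_i,\psi_i)\doteq 1$ (the $\varepsilon_i,\psi_i$ are unique up to units). The symbol $\doteq$ means equality up to multiplication by a unit of $\mathfrak{R}$ (for scalars) or by a diagonal unimodular matrix (for matrices); ''the'' Smith(-McMillan) form is understood up to $\doteq$. Statements of the form ''the Smith form of $M$ is $\operatorname{Diag}(\dots)\oplus 0$'' include the corresponding divisibility chains (e.g. $S_A\doteq\operatorname{Diag}(\psi_n,\dots,\psi_1)$ means $\psi_n\mid\cdots\mid\psi_1$). $G_1\in\mathfrak{R}^{p\times m}$ and $G_2\in\mathfrak{R}^{q\times m}$ are right coprime if every $F\in\mathfrak{R}^{m\times m}$ with $G_1=\widetilde G_1F$, $G_2=\widetilde G_2F$ for some matrices $\widetilde G_1,\widetilde G_2$ over $\mathfrak{R}$ is unimodular. $H_1,H_2$ (same number of rows) are left coprime if $H_1^T,H_2^T$ are right coprime. $\oplus$ denotes the block diagonal sum; $0_{0\times q}$ (resp. $0_{p\times 0}$) in a direct sum means appending $q$ zero columns (resp. $p$ zero rows). *)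

(* Defs.v *)
From mathcomp Require Import all_boot all_order all_algebra.

Set Implicit Arguments.
Unset Strict Implicit.
Unset Printing Implicit Defensive.

Import GRing.Theory.
Local Open Scope ring_scope.

Notation "x %:F" := (@FracField.tofrac _ x) : ring_scope.

Section Divisibility.
Variable R : idomainType.
Implicit Types (a b c d : R) (s : seq R).

Definition dvdr a b : Prop := exists c, b = c * a.

Definition is_gcd d s : Prop :=
  (forall a, a \in s -> dvdr d a) /\
  (forall e, (forall a, a \in s -> dvdr e a) -> dvdr e d).

Definition elementary_divisor_domain : Prop :=
  forall a b c, exists x y z w : R,
    is_gcd (z * x * a + z * y * b + w * y * c) [:: a; b; c].

Definition dvdr_chain s : Prop :=
  forall i, (i.+1 < size s)%N -> dvdr s`_i s`_i.+1.

End Divisibility.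

(* Diag(s_0, ..., s_(k-1)) (+) 0_((p-k) x (m-k)), meaningful when
   k = size s <= minn p m.  Since s`_i = 0 for i >= size s, the zero block is
   implicit, and a block I_n in front is obtained by prefixing nseq n 1. *)
Definition diag_rect (K : nmodType) (p m : nat) (s : seq K) : 'M[K]_(p, m) :=
  \matrix_(i < p, j < m) (if i == j :> nat then s`_i else 0).

Section Forms.
Variable R : idomainType.
Implicit Types p m : nat.

Definition frac_mx p m (M : 'M[R]_(p, m)) : 'M[{fraction R}]_(p, m) :=
  map_mx (@FracField.tofrac R) M.

Definition mx_equiv p m (M N : 'M[{fraction R}]_(p, m)) : Prop :=
  exists (U : 'M[R]_p) (V : 'M[R]_m),
    [/\ U \in unitmx, V \in unitmx & frac_mx U *m M *m frac_mx V = N].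

(* "The" Smith form is only defined up to units: "the Smith form of M is
   Diag(alpha) (+) 0 up to units" means that Diag(alpha) (+) 0 is a Smith form
   of M.  The condition on the size, a rank, forces size alpha <= minn p m.
   The same conventions apply to the Smith-McMillan form below. *)
Definition is_smith_form p m (M : 'M[R]_(p, m)) (alpha : seq R) : Prop :=
  [/\ size alpha = \rank (frac_mx M),
      forall i, (i < size alpha)%N -> alpha`_i != 0,
      dvdr_chain alpha
    & mx_equiv (frac_mx M) (frac_mx (diag_rect p m alpha))].

Definition quotients (eps psi : seq R) : seq {fraction R} :=
  [seq e.1%:F / e.2%:F | e <- zip eps psi].

Definition is_smith_mcmillan_form p m (G : 'M[{fraction R}]_(p, m))
    (eps psi : seq R) : Prop :=
  [/\ size eps = \rank G /\ size psi = \rank G,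
      forall i, (i < \rank G)%N -> eps`_i != 0 /\ psi`_i != 0,
      dvdr_chain eps /\ dvdr_chain (rev psi),
      forall i, (i < \rank G)%N -> is_gcd 1 [:: eps`_i; psi`_i]
    & mx_equiv G (diag_rect p m (quotients eps psi))].

Definition right_coprime p q m (G1 : 'M[R]_(p, m)) (G2 : 'M[R]_(q, m)) : Prop :=
  forall F : 'M[R]_m,
    (exists H1 : 'M[R]_(p, m), G1 = H1 *m F) ->
    (exists H2 : 'M[R]_(q, m), G2 = H2 *m F) ->
    F \in unitmx.

Definition left_coprime n m1 m2 (H1 : 'M[R]_(n, m1)) (H2 : 'M[R]_(n, m2)) :
  Prop := right_coprime H1^T H2^T.

Definition transfer_mx n m p (A : 'M[R]_n) (B : 'M[R]_(n, m))
    (C : 'M[R]_(p, n)) (D : 'M[R]_(p, m)) : 'M[{fraction R}]_(p, m) :=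
  frac_mx D - frac_mx C *m invmx (frac_mx A) *m frac_mx B.

(* psi_1, psi_2, ... is stored as psi`_0, psi`_1, ..., hence the i.+1. *)
Definition last_nonunit (psi : seq R) : nat :=
  \max_(i < size psi | psi`_i \isn't a GRing.unit) i.+1.

End Forms.

(* Main.v *)
(* The proof rests on two facts about an elementary divisor domain.  Smith forms
   exist: Kaplansky's condition yields unimodular [U], [V] such that the corner
   entry of [U *m M *m V] divides all entries of [M].  They are unique up to
   units: if [U *m diag(s) = diag(t) *m V] with [U] unimodular, every term of the
   Leibniz expansion of [det U] contains a factor [U i j] with [j <= k <= i],
   which forces [t_k] to divide [s_k].

   By left coprimeness there is a unimodular [Z] with [A B] Z = [I 0].  Its last
   block column gives a right coprime fraction [G = N Q^-1] for which
   [P ~ I + N] and [A + I ~ I + Q] (direct sums).  The Smith-McMillan form of [G]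
   gives another one, with numerator [diag(eps)] and denominator [diag(psi, 1)];
   two right coprime fractions of the same matrix differ by a unimodular right
   factor, so [N ~ diag(eps)] and [Q ~ diag(psi, 1)].  Uniqueness of the Smith form
   of [A + I] then yields that of [A].  For the converse, apply this to some
   Smith-McMillan form of [G] and use uniqueness again. *)
Require Import Defs.
From mathcomp Require Import all_boot all_order all_algebra.
From mathcomp Require Import generic_quotient perm ring zify.
Import GRing.Theory.
Local Open Scope ring_scope.

Set Implicit Arguments.
Unset Strict Implicit.
Unset Printing Implicit Defensive.

(** * Divisibility and associates in an integral domain *)

Section Divisibility.
Variable R : idomainType.
Implicit Types a b c d : R.

Definition assoc a b : Prop := exists2 u : R, u \is a GRing.unit & b = u * a.

Lemma dvdr_refl a : dvdr a a.
Proof. by exists 1; rewrite mul1r. Qed.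

Lemma dvdr0 a : dvdr a 0.
Proof. by exists 0; rewrite mul0r. Qed.

Lemma dvd1r a : dvdr 1 a.
Proof. by exists a; rewrite mulr1. Qed.

Lemma dvdr_trans b a c : dvdr a b -> dvdr b c -> dvdr a c.
Proof. by move=> [x ->] [y ->]; exists (y * x); rewrite mulrA. Qed.

Lemma dvdr_add a b c : dvdr a b -> dvdr a c -> dvdr a (b + c).
Proof. by move=> [x ->] [y ->]; exists (x + y); rewrite mulrDl. Qed.

Lemma dvdr_mull a b c : dvdr a b -> dvdr a (c * b).
Proof. by move=> [x ->]; exists (c * x); rewrite mulrA. Qed.

Lemma dvdr_mulr a b c : dvdr a b -> dvdr a (b * c).
Proof. by rewrite mulrC; exact: dvdr_mull. Qed.

Lemma dvdr_sum a (I : Type) (s : seq I) (Q : pred I) (F : I -> R) :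
  (forall i, Q i -> dvdr a (F i)) -> dvdr a (\sum_(i <- s | Q i) F i).
Proof. by move=> dvdF; elim/big_ind: _ => //; [exact: dvdr0|exact: dvdr_add]. Qed.

Lemma assoc_refl a : assoc a a.
Proof. by exists 1; rewrite ?mul1r ?unitr1. Qed.

Lemma assoc_sym a b : assoc a b -> assoc b a.
Proof. by case=> u Uu ->; exists u^-1; rewrite ?unitrV ?mulKr. Qed.

Lemma assoc_trans b a c : assoc a b -> assoc b c -> assoc a c.
Proof. by move=> [u Uu ->] [v Uv ->]; exists (v * u); rewrite ?unitrM ?Uu ?Uv ?mulrA. Qed.

Lemma assoc_dvdr a b : assoc a b -> dvdr a b.
Proof. by case=> u _ ->; exists u. Qed.

Lemma dvdr_assoc a b : dvdr a b -> dvdr b a -> assoc a b.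
Proof.
move=> [x ->] [y eq_a]; have [->|a_neq0] := eqVneq a 0.
  by rewrite mulr0; exact: assoc_refl.
exists x => //; apply/unitrPr; exists y; apply: (mulIf a_neq0).
by rewrite mul1r {2}eq_a mulrA [x * y]mulrC.
Qed.

Lemma assoc_unit a b : assoc a b -> (b \is a GRing.unit) = (a \is a GRing.unit).
Proof. by case=> u Uu ->; rewrite unitrM Uu. Qed.

Lemma unit_assoc a b : a \is a GRing.unit -> b \is a GRing.unit -> assoc a b.
Proof. by move=> Ua Ub; exists (b / a); rewrite ?unitrM ?unitrV ?Ua ?Ub ?divrK. Qed.

Lemma assoc_neq0 a b : assoc a b -> (b != 0) = (a != 0).
Proof.
case=> u Uu ->; rewrite mulf_eq0 negb_or andb_idl // => _.
by apply: contraTneq Uu => ->; rewrite unitr0.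
Qed.

(** No bound on [j] is required: past the end of the list the entry is the default 0, which
    everything divides. *)
Lemma dvdr_chain_nth (s : seq R) i j : dvdr_chain s -> (i <= j)%N -> dvdr s`_i s`_j.
Proof.
move=> chain_s; elim: j => [|j IHj]; first by rewrite leqn0 => /eqP ->; exact: dvdr_refl.
rewrite leq_eqVlt => /predU1P[->|/IHj s_ij]; first exact: dvdr_refl.
have [lt_js|le_sj] := ltnP j.+1 (size s); first exact: dvdr_trans (chain_s j lt_js).
by rewrite [X in dvdr _ X]nth_default //; exact: dvdr0.
Qed.

Lemma dvdr_chain_assoc (s t : seq R) : size s = size t ->
  (forall i, (i < size s)%N -> assoc s`_i t`_i) -> dvdr_chain s -> dvdr_chain t.
Proof.
move=> sz st chain_s i; rewrite -sz => lti.
apply: dvdr_trans (assoc_dvdr (assoc_sym (st i (ltnW lti)))) _.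
exact: dvdr_trans (chain_s i lti) (assoc_dvdr (st _ lti)).
Qed.

Lemma dvdr_chain_ones k (s : seq R) : dvdr_chain s -> dvdr_chain (nseq k 1 ++ s).
Proof.
move=> chain_s i; rewrite size_cat size_nseq => lti.
rewrite !nth_cat size_nseq !nth_nseq.
case: (ltnP i k) => [_|le_ki]; first exact: dvd1r.
by rewrite ltnNge (leq_trans le_ki) //= subSn //; apply: chain_s; rewrite -subSn // ltn_subLR // leqW.
Qed.

Lemma is_gcd1_bezout a b x y : x * a + y * b = 1 -> is_gcd 1 [:: a; b].
Proof.
move=> bez; split=> [c _|e de]; first exact: dvd1r.
by rewrite -bez; apply: dvdr_add; apply: dvdr_mull; apply: de; rewrite !inE eqxx ?orbT.
Qed.

Lemma is_gcd_assoc a b d : is_gcd d [:: a; b] ->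
  forall a' b', assoc a a' -> assoc b b' -> is_gcd d [:: a'; b'].
Proof.
move=> [dd dm] a' b' aa bb; split.
  move=> c; rewrite !inE => /orP[/eqP->|/eqP->].
    by apply: dvdr_trans (assoc_dvdr aa); apply: dd; rewrite !inE eqxx ?orbT.
  by apply: dvdr_trans (assoc_dvdr bb); apply: dd; rewrite !inE eqxx ?orbT.
move=> e de; apply: dm => c; rewrite !inE => /orP[/eqP->|/eqP->].
  by apply: dvdr_trans (assoc_dvdr (assoc_sym aa)); apply: de; rewrite !inE eqxx ?orbT.
by apply: dvdr_trans (assoc_dvdr (assoc_sym bb)); apply: de; rewrite !inE eqxx ?orbT.
Qed.

End Divisibility.

(** * Bezout identities and Gauss's lemma in an elementary divisor domain *)

Section ElementaryDivisorDomain.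
Variable R : idomainType.
Hypothesis R_edd : elementary_divisor_domain R.

(** Kaplansky's condition at [c = 0] makes the gcd a linear combination of [a] and [b]; dividing by
    it leaves comaximal cofactors. The case [a = 0] is treated apart so that the gcd can be
    cancelled. *)
Lemma edd_bezout (a b : R) : exists d a' b' x y,
  [/\ a = a' * d, b = b' * d & x * a' + y * b' = 1].
Proof.
have [x [y [z [w [dd _]]]]] := R_edd a b 0.
have [-> | nz] := eqVneq a 0.
  by exists b, 0, 1, 0, 1; split; ring.
have [a' ea] : dvdr (z * x * a + z * y * b + w * y * 0) a by apply: dd; rewrite !inE eqxx ?orbT.
have [b' eb] : dvdr (z * x * a + z * y * b + w * y * 0) b by apply: dd; rewrite !inE eqxx ?orbT.
move: ea eb; set d := (X in _ * X) => ea eb.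
have nzd : d != 0 by apply: contraNneq nz => d0; rewrite ea d0 mulr0.
exists d, a', b', (z * x), (z * y); split=> //; apply: (mulIf nzd).
by rewrite mulrDl -!mulrA -ea -eb /d mulr0 addr0 !mulrA mul1r.
Qed.

Lemma gcd1_bezout (a b : R) : is_gcd 1 [:: a; b] -> exists x y, x * a + y * b = 1.
Proof.
move=> [_ d1]; have [d [a' [b' [x [y [ea eb bez]]]]]] := edd_bezout a b.
have [c ec] : dvdr d 1.
  by apply: d1 => e; rewrite !inE => /orP[/eqP->|/eqP->]; [exists a'|exists b'].
exists (c * x), (c * y); rewrite ea eb.
by transitivity (c * d * (x * a' + y * b')); [ring|rewrite bez -ec mulr1].
Qed.

Lemma gauss_dvdr (a b c : R) : is_gcd 1 [:: a; b] -> dvdr a (b * c) -> dvdr a c.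
Proof.
move=> /gcd1_bezout[x [y bez]] [e ee]; exists (x * c + y * e).
by rewrite -[LHS]mul1r -bez !mulrDl -!mulrA ee; ring.
Qed.

End ElementaryDivisorDomain.

(** * Matrices with a common divisor, and splitting off a corner entry *)

Section DivisibleMatrices.
Variable R : idomainType.

Definition dvdr_mx p m d (M : 'M[R]_(p, m)) := forall i j, dvdr d (M i j).

Lemma dvdr_mx_mull p m q d (U : 'M[R]_(q, p)) (M : 'M[R]_(p, m)) :
  dvdr_mx d M -> dvdr_mx d (U *m M).
Proof. by move=> dM i j; rewrite mxE; apply: dvdr_sum => k _; apply: dvdr_mull. Qed.

Lemma dvdr_mx_mulr p m q d (M : 'M[R]_(p, m)) (V : 'M[R]_(m, q)) :
  dvdr_mx d M -> dvdr_mx d (M *m V).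
Proof. by move=> dM i j; rewrite mxE; apply: dvdr_sum => k _; apply: dvdr_mulr. Qed.

Lemma dvdr_mx0 p m d : dvdr_mx d (0 : 'M[R]_(p, m)).
Proof. by move=> i j; rewrite mxE; exact: dvdr0. Qed.

Lemma dvdr_mx_scalar n d a : dvdr d a -> dvdr_mx d (a%:M : 'M[R]_n).
Proof. by move=> da i j; rewrite mxE; case: (_ == _) => //; exact: dvdr0. Qed.

Lemma dvdr_mx_row p m1 m2 d (M1 : 'M[R]_(p, m1)) (M2 : 'M[R]_(p, m2)) :
  dvdr_mx d M1 -> dvdr_mx d M2 -> dvdr_mx d (row_mx M1 M2).
Proof. by move=> d1 d2 i j; rewrite mxE; case: split. Qed.

Lemma dvdr_mx_col p1 p2 m d (M1 : 'M[R]_(p1, m)) (M2 : 'M[R]_(p2, m)) :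
  dvdr_mx d M1 -> dvdr_mx d M2 -> dvdr_mx d (col_mx M1 M2).
Proof. by move=> d1 d2 i j; rewrite mxE; case: split. Qed.

Lemma dvdr_mxP p m d (M : 'M[R]_(p, m)) : dvdr_mx d M -> exists N, M = d *: N.
Proof.
move=> dM; have /fin_all_exists[f Ef] : forall ij : 'I_p * 'I_m, exists c, M ij.1 ij.2 = c * d.
  by move=> ij; exact: dM.
by exists (\matrix_(i, j) f (i, j)); apply/matrixP=> i j; rewrite !mxE mulrC (Ef (i, j)).
Qed.

(** The 2-by-2 matrix with rows [a b] and [c d], bordered by an identity block: it acts on the first
    two coordinates only. *)
Definition embed2 m (a b c d : R) : 'M[R]_(1 + (1 + m)) :=
  block_mx a%:M (row_mx b%:M 0) (col_mx c%:M 0) (block_mx d%:M 0 0 1%:M).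

Lemma embed2M m a b c d a' b' c' d' :
  embed2 m a b c d *m embed2 m a' b' c' d' =
  embed2 m (a * a' + b * c') (a * b' + b * d') (c * a' + d * c') (c * b' + d * d').
Proof.
rewrite /embed2 mulmx_block !mulmx_block mul_row_col mul_mx_row mul_row_block.
rewrite mul_col_mx mul_block_col mul_col_row !(mulmx0, mul0mx, addr0, add0r, mulmx1).
rewrite add_row_mx add_col_mx add_block_mx !(addr0, add0r) -!scalar_mxM.
by rewrite !raddfD.
Qed.

Lemma embed2_unit m a b c d : a * d - b * c = 1 -> embed2 m a b c d \in unitmx.
Proof.
(* The inverse is the adjugate of the 2-by-2 part. *)
move=> det1; suff: embed2 m a b c d *m embed2 m d (- b) (- c) a = 1%:M.
  by case/mulmx1_unit.
rewrite embed2M /embed2.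
have -> : a * d + b * - c = 1 by rewrite -det1; ring.
have -> : a * - b + b * a = 0 by ring.
have -> : c * d + d * - c = 0 by ring.
have -> : c * - b + d * a = 1 by rewrite -det1; ring.
by rewrite !raddf0 row_mx0 col_mx0 -!scalar_mx_block.
Qed.

(** One step of the Smith reduction; [d] becomes an invariant factor, and its divisibility of [M']
    feeds the chain condition. *)
Definition corner_reducible p m (M : 'M[R]_(1 + p, 1 + m)) : Prop :=
  exists (U : 'M[R]_(1 + p)) (V : 'M[R]_(1 + m)) d M',
  [/\ U \in unitmx, V \in unitmx, U *m M *m V = block_mx d%:M 0 0 M' & dvdr_mx d M'].

Lemma corner_reducible_equiv p m (M : 'M[R]_(1 + p, 1 + m)) U V :
  U \in unitmx -> V \in unitmx -> corner_reducible (U *m M *m V) -> corner_reducible M.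
Proof.
move=> UU UV [U' [V' [d [M' [UU' UV' EM dM]]]]].
exists (U' *m U), (V *m V'), d, M'; split=> //; rewrite ?unitmx_mul ?UU ?UU' ?UV ?UV' //.
by rewrite -EM !mulmxA.
Qed.

Lemma corner_reducible_tr p m (M : 'M[R]_(1 + p, 1 + m)) :
  corner_reducible M^T -> corner_reducible M.
Proof.
move=> [U [V [d [M' [UU UV EM dM]]]]].
exists V^T, U^T, d, M'^T; split; rewrite ?unitmx_tr //; last by move=> i j; rewrite mxE.
have -> : V^T *m M *m U^T = (U *m M^T *m V)^T by rewrite !trmx_mul trmxK mulmxA.
by rewrite EM tr_block_mx !trmx0 tr_scalar_mx.
Qed.

(** The corner divides the rest of its row and of its column, so one elementary block matrix on each
    side clears them. *)
Lemma corner_reducible_dvdr p m (M : 'M[R]_(1 + p, 1 + m)) d :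
  ulsubmx M = d%:M -> dvdr_mx d M -> corner_reducible M.
Proof.
move=> ul dM.
have [r Er] : exists r, ursubmx M = d *: r by apply: dvdr_mxP => i j; rewrite !mxE.
have [c Ec] : exists c, dlsubmx M = d *: c by apply: dvdr_mxP => i j; rewrite !mxE.
pose U : 'M[R]_(1 + p) := block_mx 1%:M 0 (- c) 1%:M.
pose V : 'M[R]_(1 + m) := block_mx 1%:M (- r) 0 1%:M.
exists U, V, d, (drsubmx M - c *m (d *: r)); split.
- by rewrite unitmxE det_lblock !det1 mulr1 unitr1.
- by rewrite unitmxE det_ublock !det1 mulr1 unitr1.
- rewrite -{1}[M]submxK ul Er Ec /U /V !mulmx_block.
  rewrite !(mul1mx, mulmx1, mul0mx, mulmx0, addr0, add0r) !mulNmx mul_mx_scalar addNr.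
  by rewrite mul0mx add0r mulmxN mul_scalar_mx addNr [- _ + _]addrC.
(* The remaining block is the right part of this product, hence a combination of entries of [M]. *)
- have dX : dvdr_mx d (row_mx (- c) 1%:M *m M) by apply: dvdr_mx_mull.
  move=> i j; have := dX i (rshift _ j); rewrite -{1}[M]submxK mul_row_block.
  by rewrite row_mxEr Er !mul1mx !mulNmx [- _ + _]addrC.
Qed.

End DivisibleMatrices.

(** * Existence of the Smith reduction *)

Section SmithReduction.
Variable R : idomainType.
Hypothesis R_edd : elementary_divisor_domain R.

(** Induction on the length: once the tail is reduced to a single entry [d], a determinant-one
    matrix built from a Bezout identity merges [d] with the first entry. *)
Lemma bezout_row m (r : 'rV[R]_(1 + m)) :
  exists2 V, V \in unitmx & exists d, r *m V = row_mx d%:M 0.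
Proof.
elim: m r => [|m IHm] r.
  exists 1%:M; first exact: unitmx1.
  by exists (lsubmx r 0 0); rewrite mulmx1 -mx11_scalar -{1}[r]hsubmxK [rsubmx r]thinmx0.
rewrite -[m.+1]/(1 + m)%N in r *; have [V UV [d Ed]] := IHm (rsubmx r).
have [g [a [b [x [y [Ea Eb bez]]]]]] := edd_bezout R_edd (lsubmx r 0 0) d.
exists (block_mx 1%:M 0 0 V *m embed2 m x (- b) y a).
  rewrite unitmx_mul unitmxE det_lblock det1 mul1r -unitmxE UV.
  by apply: embed2_unit; rewrite -bez; ring.
exists g; rewrite -[r]hsubmxK mulmxA mul_row_block mulmx1 !mulmx0 addr0 add0r Ed.
rewrite /embed2 mul_row_block mul_row_col mul_mx_row mul_row_block [lsubmx r]mx11_scalar Ea Eb.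
rewrite !(mulmx0, mul0mx, addr0, add0r) -!scalar_mxM add_row_mx addr0 -!raddfD /=.
have -> : a * g * x + b * g * y = g by rewrite -[RHS]mul1r -bez; ring.
have -> : a * g * - b + b * g * a = 0 by ring.
by rewrite raddf0 row_mx0.
Qed.

(** The coefficient pairs [x, y] and [z, w] can be taken comaximal, so that each completes to a
    2-by-2 matrix of determinant one. If the gcd is 0 then [a], [b], [c] all vanish and trivial
    coefficients do; otherwise the gcd is cancelled from its own expression. *)
Lemma edd_kaplansky (a b c : R) : exists x y z w x' y' z' w',
  let d := z * x * a + z * y * b + w * y * c in
  [/\ dvdr d a, dvdr d b, dvdr d c, x * x' + y * y' = 1 & z * z' + w * w' = 1].
Proof.
have [x [y [z [w [dd _]]]]] := R_edd a b c.
have [a' Ea] : dvdr (z * x * a + z * y * b + w * y * c) a by apply: dd; rewrite !inE eqxx ?orbT.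
have [b' Eb] : dvdr (z * x * a + z * y * b + w * y * c) b by apply: dd; rewrite !inE eqxx ?orbT.
have [c' Ec] : dvdr (z * x * a + z * y * b + w * y * c) c by apply: dd; rewrite !inE eqxx ?orbT.
have [d0|nzd] := eqVneq (z * x * a + z * y * b + w * y * c) 0.
  move: Ea Eb Ec; rewrite d0 !mulr0 => -> -> ->.
  by exists 1, 0, 1, 0, 1, 0, 1, 0; split; rewrite ?mulr0 ?mul0r ?mulr1 ?addr0 //; exact: dvdr_refl.
have bez : z * x * a' + z * y * b' + w * y * c' = 1.
  apply: (mulIf nzd); move: Ea Eb Ec; set d := z * x * a + _ + _ => Ea Eb Ec.
  rewrite mul1r; transitivity (z * x * (a' * d) + z * y * (b' * d) + w * y * (c' * d)); first by ring.
  by rewrite -Ea -Eb -Ec.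
(* The cofactors come from collecting [bez] first along [x] and [y], then along [z] and [w]. *)
exists x, y, z, w, (z * a'), (z * b' + w * c'), (x * a' + y * b'), (y * c').
by split; [exists a'|exists b'|exists c'| |] => //; rewrite -bez; ring.
Qed.

Lemma corner_reducible_row m (M : 'M[R]_(1 + 0, 1 + m)) : corner_reducible M.
Proof.
have [V UV [d Ed]] := bezout_row (usubmx M).
exists 1%:M, V, d, 0; split; rewrite ?unitmx1 //; last exact: dvdr_mx0.
rewrite mul1mx -[M]vsubmxK mul_col_mx Ed block_mxEv; congr col_mx.
by rewrite [LHS]flatmx0 [RHS]flatmx0.
Qed.

(* Once the lower rows have corner [d] dividing all their other entries, and the
   first row is [r0 e 0 ... 0], every entry is divisible by [gcd(e, r0, d)], which
   Kaplansky's condition moves into the corner. *)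
Lemma corner_reducibleT p m (M : 'M[R]_(1 + p, 1 + m)) : corner_reducible M.
Proof.
elim: p m M => [|p IHp] m M; first exact: corner_reducible_row.
case: m M => [|m] M; first by apply: corner_reducible_tr; exact: corner_reducible_row.
rewrite -[p.+1]/(1 + p)%N -[m.+1]/(1 + m)%N in M *.
have [U [V [d [M' [UU UV EM dM]]]]] := IHp _ (dsubmx M).
have [V2 UV2 [e Ee]] := bezout_row (rsubmx (usubmx M *m V)).
set r0 := lsubmx (usubmx M *m V) 0 0.
pose K := M' *m V2.
have dK : dvdr_mx d K by exact: dvdr_mx_mulr.
pose N := block_mx r0%:M (row_mx e%:M 0) (col_mx d%:M 0) (block_mx 0 0 (lsubmx K) (rsubmx K)).
have EN : block_mx 1%:M 0 0 U *m M *m (V *m block_mx 1%:M 0 0 V2) = N.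
  rewrite -[M in LHS]vsubmxK mul_block_col !mul1mx !mul0mx addr0 add0r !mulmxA mul_col_mx EM.
  rewrite -[usubmx M *m V]hsubmxK mul_col_mx mul_row_block mulmx_block [lsubmx _]mx11_scalar.
  rewrite !(mulmx0, mul0mx, addr0, add0r, mulmx1) Ee /N -/r0.
  rewrite block_mxEv; congr col_mx.
  rewrite -block_mxEv [LHS]block_mxEh; congr row_mx.
  by rewrite block_mxEv row_mx0 hsubmxK.
apply: (@corner_reducible_equiv _ _ _ _ (block_mx 1%:M 0 0 U) (V *m block_mx 1%:M 0 0 V2)).
- by rewrite unitmxE det_lblock det1 mul1r -unitmxE.
- by rewrite unitmx_mul UV unitmxE det_lblock det1 mul1r -unitmxE.
rewrite EN.
(* The leading 2-by-2 block of [N] has rows [r0 e] and [d 0]. Multiplied by [z w] on the left and by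
   the column [x y] on the right it gives [z x r0 + z y e + w x d]. So [r0] takes the middle place
   in Kaplansky's condition, and [x] and [y] are exchanged. *)
have [y [x [z [w [y' [x' [z' [w' [de dr dd bezxy bezzw]]]]]]]]] := edd_kaplansky e r0 d.
set g := (X in dvdr X e) in de dr dd.
pose E1 := embed2 p z w (- w') z'; pose E2 := embed2 m x (- y') y x'.
apply: (@corner_reducible_equiv _ _ _ _ E1 E2).
- by apply: embed2_unit; rewrite -bezzw; ring.
- by apply: embed2_unit; rewrite -bezxy; ring.
apply: (@corner_reducible_dvdr _ _ _ _ g).
  rewrite /E1 /E2 /N /embed2 !mulmx_block block_mxKul mul_row_block mul_row_col.
  rewrite mul_mx_row !(mulmx0, mul0mx, addr0, add0r) add_row_mx mul_row_col.
  rewrite !(mulmx0, mul0mx, addr0, add0r) -!scalar_mxM -!raddfD -!scalar_mxM -raddfD /g /=.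
  by congr _%:M; ring.
apply: dvdr_mx_mulr; apply: dvdr_mx_mull.
have dgK : dvdr_mx g K by move=> i j; exact: dvdr_trans (dK i j).
rewrite /N; apply: dvdr_mx_col; apply: dvdr_mx_row.
- exact: dvdr_mx_scalar.
- by apply: dvdr_mx_row; [exact: dvdr_mx_scalar|exact: dvdr_mx0].
- by apply: dvdr_mx_col; [exact: dvdr_mx_scalar|exact: dvdr_mx0].
apply: dvdr_mx_col; first by apply: dvdr_mx_row; exact: dvdr_mx0.
by rewrite hsubmxK.
Qed.

(** Each corner divides the block that remains, and this survives the unimodular multiplications
    applied to that block later; hence the chain. A zero corner forces the whole remaining block to
    vanish, so the list stops there and keeps only nonzero entries. *)
Lemma smith_reduction p m (M : 'M[R]_(p, m)) : exists U V s,
  [/\ U \in unitmx, V \in unitmx, (size s <= minn p m)%N,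
      forall i, (i < size s)%N -> s`_i != 0 & dvdr_chain s] /\
  U *m M *m V = diag_rect p m s.
Proof.
elim: p m M => [|p IHp] m M.
  exists 1%:M, 1%:M, [::]; split; first by split; rewrite ?unitmx1.
  by rewrite [LHS]flatmx0 [RHS]flatmx0.
case: m M => [|m] M.
  exists 1%:M, 1%:M, [::]; split; first by split; rewrite ?unitmx1.
  by rewrite [LHS]thinmx0 [RHS]thinmx0.
rewrite -[p.+1]/(1 + p)%N -[m.+1]/(1 + m)%N in M *.
have [U [V [d [M' [UU UV EM dM]]]]] := corner_reducibleT M.
have [d0|nzd] := eqVneq d 0.
  exists U, V, [::]; split; first by split.
  rewrite EM; apply/matrixP=> i j; rewrite [RHS]mxE nth_nil if_same.
  have -> : M' = 0 by apply/matrixP=> i' j'; have [c ->] := dM i' j'; rewrite d0 mulr0 mxE.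
  by rewrite d0 raddf0 block_mx0 mxE.
have [U' [V' [s [[UU' UV' sz nz chain_s] EM']]]] := IHp _ M'.
exists (block_mx 1%:M 0 0 U' *m U), (V *m block_mx 1%:M 0 0 V'), (d :: s).
have ds : dvdr d s`_0.
  have [s0|s_gt0] := posnP (size s); first by rewrite nth_default ?s0 //; exact: dvdr0.
  have [p0 m0] : (0 < p /\ 0 < m)%N by apply/andP; rewrite -leq_min (leq_trans s_gt0).
  have := dvdr_mx_mulr V' (dvdr_mx_mull U' dM); rewrite EM'.
  by move/(_ (Ordinal p0) (Ordinal m0)); rewrite mxE.
split; first split.
- by rewrite unitmx_mul UU andbT unitmxE det_lblock det1 mul1r -unitmxE.
- by rewrite unitmx_mul UV unitmxE det_lblock det1 mul1r -unitmxE.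
- by rewrite /= (minnSS p m) ltnS.
- by case.
- by case=> [|i] //; exact: chain_s.
rewrite -!mulmxA [U *m _]mulmxA [_ *m (V *m _)]mulmxA EM !mulmx_block.
rewrite !(mulmx0, mul0mx, addr0, add0r, mulmx1, mul1mx) mulmxA EM'.
apply/matrixP=> i j; rewrite [RHS]mxE.
rewrite -[i](splitK (m := 1) (n := p)) -[j](splitK (m := 1) (n := m)).
case: split => i'; case: split => j' /=.
- by rewrite block_mxEul mxE !ord1.
- by rewrite block_mxEur mxE ord1.
- by rewrite block_mxEdl mxE ord1.
- by rewrite block_mxEdr mxE !add1n eqSS.
Qed.

End SmithReduction.

(** * Rectangular diagonal matrices *)

Lemma nth_map0 (V W : nmodType) (f : V -> W) (s : seq V) i :
  f 0 = 0 -> (map f s)`_i = f s`_i.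
Proof.
move=> f0; have [lt_is|le_si] := ltnP i (size s); first exact: nth_map.
by rewrite !nth_default ?size_map.
Qed.

Section DiagRect.

Lemma map_diag_rect (V W : nmodType) (f : V -> W) p m (s : seq V) :
  f 0 = 0 -> map_mx f (diag_rect p m s) = diag_rect p m (map f s).
Proof.
by move=> f0; apply/matrixP=> i j; rewrite !mxE nth_map0 //; case: eqP.
Qed.

Lemma diag_rect_cat (V : nmodType) n p m (s t : seq V) : size s = n ->
  diag_rect (n + p) (n + m) (s ++ t) = block_mx (diag_rect n n s) 0 0 (diag_rect p m t).
Proof.
move=> sz; apply/matrixP=> i j; rewrite [LHS]mxE nth_cat sz.
rewrite -[i]splitK -[j]splitK; case: split => i'; case: split => j' /=.
- by rewrite block_mxEul mxE ltn_ord.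
- by rewrite block_mxEur mxE ltn_eqF // (leq_trans (ltn_ord i')) ?leq_addr.
- by rewrite block_mxEdl mxE gtn_eqF // (leq_trans (ltn_ord j')) ?leq_addr.
- by rewrite block_mxEdr mxE eqn_add2l ltnNge leq_addr addKn.
Qed.

Lemma diag_rect_ones (A : pzSemiRingType) n : diag_rect n n (nseq n 1) = 1%:M :> 'M[A]_n.
Proof. by apply/matrixP=> i j; rewrite !mxE nth_nseq ltn_ord -val_eqE; case: eqP. Qed.

Lemma diag_rect_col (V : nmodType) n p (s : seq V) : (size s <= n)%N ->
  diag_rect (n + p) n s = col_mx (diag_rect n n s) 0.
Proof.
move=> sz; apply/matrixP=> i j; rewrite !mxE; case: splitP => k ->; rewrite mxE //.
by rewrite gtn_eqF // (leq_trans (ltn_ord j)) ?leq_addr.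
Qed.

Lemma mul_diag_rect (A : comPzRingType) p n m (s t u : seq A) :
  (forall i, (i < p)%N -> (i < m)%N -> u`_i = if (i < n)%N then s`_i * t`_i else 0) ->
  diag_rect p n s *m diag_rect n m t = diag_rect p m u.
Proof.
move=> Eu; apply/matrixP=> i j; rewrite !mxE.
have [eq_ij|neq_ij] := eqVneq.
  rewrite Eu ?eq_ij //; last by rewrite -eq_ij.
  case: ltnP => [lt_jn|le_nj].
    rewrite (bigD1 (Ordinal lt_jn)) //= !mxE eq_ij !eqxx big1 ?addr0 // => k neq_kj.
    by rewrite !mxE -val_eqE /= in neq_kj *; rewrite (negPf neq_kj) mulr0.
  rewrite big1 // => k _; rewrite !mxE eq_ij gtn_eqF ?mul0r //.
  exact: leq_trans (ltn_ord k) le_nj.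
rewrite big1 // => k _; rewrite !mxE.
by case: eqP => [<-|]; rewrite ?mul0r // (negPf neq_ij) mulr0.
Qed.

Lemma perm_diag_rect (A : pzSemiRingType) n (s t : seq A) : size s = n -> perm_eq s t ->
  exists sigma : 'S_n, diag_rect n n s = perm_mx sigma *m diag_rect n n t *m (perm_mx sigma)^T.
Proof.
move=> sz eq_st; have sz_t : size t == n by rewrite -(perm_size eq_st) sz.
have [sigma Es] := tuple_permP (eq_st : perm_eq s (Tuple sz_t)).
exists sigma; rewrite tr_perm_mx -row_permE -col_permE; apply/matrixP=> i j.
rewrite !mxE [in LHS]Es (nth_map i) ?size_enum_ord // nth_ord_enum (tnth_nth 0) /=.
by rewrite !val_eqE (inj_eq perm_inj).
Qed.

Lemma rank_diag_rect (K : fieldType) p m (s : seq K) : (size s <= minn p m)%N ->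
  (forall i, (i < size s)%N -> s`_i != 0) -> \rank (diag_rect p m s) = size s.
Proof.
rewrite leq_min => /andP[le_sp le_sm] nz.
(* Padding [s] with 1 instead of 0 makes the diagonal factor invertible; [pid_mx] then carries the
   rank. *)
have -> : diag_rect p m s = diag_mx (\row_(i < p) nth 1 s i) *m pid_mx (size s).
  apply/matrixP=> i j; rewrite mul_diag_mx !mxE.
  case: eqP => //= _; rewrite ?mulr0 //; case: ltnP => [lt_is|le_si].
    by rewrite mulr1; exact: set_nth_default.
  by rewrite mulr0 nth_default.
rewrite eqmxMfull ?rank_pid_mx // row_full_unit unitmxE det_diag unitfE.
apply/prodf_neq0 => i _; rewrite mxE.
have [lt_is|le_si] := ltnP i (size s); last by rewrite nth_default ?oner_eq0.
by rewrite (set_nth_default 0) ?nz.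
Qed.

End DiagRect.

(** * Unimodular equivalence and uniqueness of the Smith form *)

Section Equivalence.
Variable R : idomainType.
Local Notation F := {fraction R}.
Local Notation tofrac := (@FracField.tofrac R).

Lemma tofrac_inj : injective tofrac.
Proof. by move=> a b /eqP; rewrite tofrac_eq => /eqP. Qed.

Lemma frac_mx_inj p m : injective (@frac_mx R p m).
Proof.
move=> M N /matrixP eqMN; apply/matrixP=> i j.
by have := eqMN i j; rewrite !mxE => /tofrac_inj.
Qed.

Lemma frac_mxM p n m (M : 'M[R]_(p, n)) (N : 'M[R]_(n, m)) :
  frac_mx (M *m N) = frac_mx M *m frac_mx N.
Proof. exact: map_mxM. Qed.

Lemma frac_mx1 n : frac_mx 1%:M = 1%:M :> 'M[F]_n.
Proof. exact: map_mx1. Qed.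

Lemma frac_diag_rect p m (s : seq R) :
  frac_mx (diag_rect p m s) = diag_rect p m (map tofrac s).
Proof. by apply: map_diag_rect; rewrite tofrac0. Qed.

Lemma frac_mx_det n (M : 'M[R]_n) : \det M != 0 -> frac_mx M \in unitmx.
Proof. by move=> nz; rewrite unitmxE det_map_mx unitfE tofrac_eq0. Qed.

Lemma frac_mx_unit n (M : 'M[R]_n) : M \in unitmx -> frac_mx M \in unitmx.
Proof. by rewrite !unitmxE det_map_mx => /rmorph_unit ->. Qed.

Lemma mx_equiv_refl p m (M : 'M[F]_(p, m)) : mx_equiv M M.
Proof. by exists 1%:M, 1%:M; rewrite !unitmx1 !frac_mx1 mul1mx mulmx1. Qed.

Lemma mx_equiv_sym p m (M N : 'M[F]_(p, m)) : mx_equiv M N -> mx_equiv N M.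
Proof.
move=> [U [V [UU UV <-]]]; exists (invmx U), (invmx V); rewrite !unitmx_inv; split=> //.
rewrite !mulmxA -frac_mxM mulVmx // frac_mx1 mul1mx -mulmxA -frac_mxM mulmxV //.
by rewrite frac_mx1 mulmx1.
Qed.

Lemma mx_equiv_trans p m (N M L : 'M[F]_(p, m)) :
  mx_equiv M N -> mx_equiv N L -> mx_equiv M L.
Proof.
move=> [U [V [UU UV <-]]] [U' [V' [UU' UV' <-]]].
by exists (U' *m U), (V *m V'); rewrite !unitmx_mul UU UU' UV UV' !frac_mxM !mulmxA.
Qed.

Lemma mx_equiv_frac p m (M N : 'M[R]_(p, m)) U V :
  U \in unitmx -> V \in unitmx -> U *m M *m V = N -> mx_equiv (frac_mx M) (frac_mx N).
Proof. by move=> UU UV <-; exists U, V; rewrite !frac_mxM. Qed.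

Lemma mx_equiv_block p1 p2 m1 m2 (M1 N1 : 'M[R]_(p1, m1)) (M2 N2 : 'M[R]_(p2, m2)) :
  mx_equiv (frac_mx M1) (frac_mx N1) -> mx_equiv (frac_mx M2) (frac_mx N2) ->
  mx_equiv (frac_mx (block_mx M1 0 0 M2)) (frac_mx (block_mx N1 0 0 N2)).
Proof.
move=> [U1 [V1 [UU1 UV1 E1]]] [U2 [V2 [UU2 UV2 E2]]].
apply: (@mx_equiv_frac _ _ _ _ (block_mx U1 0 0 U2) (block_mx V1 0 0 V2)).
- by rewrite unitmxE det_ublock unitrM -!unitmxE UU1.
- by rewrite unitmxE det_ublock unitrM -!unitmxE UV1.
rewrite !mulmx_block !(mulmx0, mul0mx, addr0, add0r).
by congr block_mx; apply: frac_mx_inj; rewrite !frac_mxM.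
Qed.

Lemma mx_equiv_rank p m (M N : 'M[F]_(p, m)) : mx_equiv M N -> \rank M = \rank N.
Proof.
move=> [U [V [UU UV <-]]].
rewrite mxrankMfree ?row_free_unit ?frac_mx_unit //.
by rewrite eqmxMfull // row_full_unit frac_mx_unit.
Qed.

Lemma mx_equiv_perm n (s t : seq R) : size s = n -> perm_eq s t ->
  mx_equiv (frac_mx (diag_rect n n s)) (frac_mx (diag_rect n n t)).
Proof.
move=> sz /(perm_diag_rect sz)[sigma ->]; apply: mx_equiv_sym.
by apply: mx_equiv_frac (erefl _); rewrite ?unitmx_tr unitmx_perm.
Qed.

(** The units are collected in a diagonal matrix on the left. Entries lie in the fraction field so
    that Smith and Smith-McMillan forms are both covered. *)
Lemma mx_equiv_diag_assoc p m (M : 'M[F]_(p, m)) (s t : seq F) :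
  (forall i, exists2 u : R, u \is a GRing.unit & t`_i = u%:F * s`_i) ->
  mx_equiv M (diag_rect p m s) -> mx_equiv M (diag_rect p m t).
Proof.
move=> st; move/mx_equiv_trans; apply.
have /fin_all_exists2[u Uu Eu] : forall i : 'I_p, exists2 u : R,
   u \is a GRing.unit & t`_i = u%:F * s`_i by move=> i; exact: st.
exists (diag_mx (\row_i u i)), 1%:M; rewrite unitmx1; split=> //.
  by rewrite unitmxE det_diag; apply: rpred_prod => i _; rewrite mxE.
rewrite frac_mx1 mulmx1 /frac_mx map_diag_mx mul_diag_mx.
by apply/matrixP=> i j; rewrite !mxE Eu; case: eqP; rewrite ?mulr0.
Qed.

(* If [k <= i] and [j <= k] then [t_k] divides [U i j * s_k]; by pigeonhole every
   term of the Leibniz expansion of [det U] has such an entry as a factor, and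
   [det U] is a unit. *)
Lemma diag_rect_dvdr p m (s t : seq R) (U : 'M[R]_p) (V : 'M[R]_m) k :
  U \in unitmx -> U *m diag_rect p m s = diag_rect p m t *m V ->
  dvdr_chain s -> dvdr_chain t -> (k < minn p m)%N -> dvdr t`_k s`_k.
Proof.
rewrite leq_min unitmxE => UU eqUV chain_s chain_t /andP[lt_kp lt_km].
have entry (i j : 'I_p) : (k <= i)%N -> (j <= k)%N -> dvdr t`_k (U i j * s`_k).
  move=> le_ki le_jk; pose j' := Ordinal (leq_ltn_trans le_jk lt_km).
  apply: (@dvdr_trans _ (U i j * s`_j)); last first.
    have [c ->] := dvdr_chain_nth chain_s le_jk.
    by exists c; rewrite mulrCA.
  have -> : U i j * s`_j = (diag_rect p m t *m V) i j'.
    rewrite -eqUV mxE (bigD1 j) //= big1 => [|l neq_lj]; first by rewrite addr0 mxE eqxx.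
    by rewrite mxE [_ == _ :> nat](negPf neq_lj) mulr0.
  rewrite mxE; apply: dvdr_sum => l _; apply: dvdr_mulr; rewrite mxE.
  by case: ifP => _; [exact: dvdr_chain_nth|exact: dvdr0].
have : dvdr t`_k (\det U * s`_k).
  rewrite mulr_suml; apply: dvdr_sum => sigma _.
  have [i le_ki le_sik] : exists2 i : 'I_p, (k <= i)%N & (sigma i <= k)%N.
    apply/exists_inP; apply: contraT; rewrite negb_exists_in => /forall_inP no_i.
    (* Otherwise [sigma] would send the indices at least [k] injectively into those greater than
       [k], of which there is one fewer. *)
    pose I := [set i : 'I_p | (k <= i)%N].
    have : [set sigma i | i in I] \proper I.
      apply/properP; split.
        apply/subsetP=> _ /imsetP[i Ii ->]; rewrite !inE in Ii *.
        by rewrite ltnW // ltnNge no_i.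
      exists (Ordinal lt_kp); first by rewrite inE.
      apply/imsetP=> -[i Ii /(congr1 val) /= Ek]; rewrite inE in Ii.
      by have := no_i i Ii; rewrite -Ek leqnn.
    by move/proper_card; rewrite card_imset ?ltnn //; exact: perm_inj.
  by rewrite (bigD1 i) //= mulrCA mulrAC; apply: dvdr_mulr; exact: entry.
by move/(dvdr_mull (\det U)^-1); rewrite mulKr.
Qed.

(** Equivalence is symmetric, so [diag_rect_dvdr] gives divisibility both ways. From [minn p m] on,
    both entries are the default 0. *)
Lemma diag_rect_equiv_assoc p m (s t : seq R) :
  (size s <= minn p m)%N -> (size t <= minn p m)%N -> dvdr_chain s -> dvdr_chain t ->
  mx_equiv (frac_mx (diag_rect p m s)) (frac_mx (diag_rect p m t)) ->
  forall i, assoc s`_i t`_i.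
Proof.
have dvd (s' t' : seq R) k : dvdr_chain s' -> dvdr_chain t' -> (k < minn p m)%N ->
    mx_equiv (frac_mx (diag_rect p m s')) (frac_mx (diag_rect p m t')) -> dvdr t'`_k s'`_k.
  move=> cs ct lt_k [U [V [UU UV E]]]; apply: diag_rect_dvdr cs ct lt_k; first exact: UU.
  instantiate (1 := invmx V); apply: frac_mx_inj; rewrite !frac_mxM -E -mulmxA -[frac_mx V *m _]frac_mxM.
  by rewrite mulmxV // frac_mx1 mulmx1.
move=> sz_s sz_t cs ct eq_st k; have [lt_k|le_k] := ltnP k (minn p m).
  by apply: dvdr_assoc; apply: dvd => //; exact: mx_equiv_sym.
by rewrite !nth_default ?(leq_trans _ le_k) //; exact: assoc_refl.
Qed.

Lemma is_smith_form_size p m (M : 'M[R]_(p, m)) s :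
  is_smith_form M s -> (size s <= minn p m)%N.
Proof. by case=> -> _ _ _; rewrite leq_min rank_leq_row rank_leq_col. Qed.

(** The rank condition comes for free: equivalence preserves the rank, and that of the diagonal
    matrix is its number of nonzero entries. *)
Lemma is_smith_formP p m (M : 'M[R]_(p, m)) s : (size s <= minn p m)%N ->
  (forall i, (i < size s)%N -> s`_i != 0) -> dvdr_chain s ->
  mx_equiv (frac_mx M) (frac_mx (diag_rect p m s)) -> is_smith_form M s.
Proof.
move=> sz nz chain_s eqM; split=> //; rewrite (mx_equiv_rank eqM) frac_diag_rect.
rewrite rank_diag_rect ?size_map // => i lt_i.
by rewrite (nth_map 0) // tofrac_eq0 nz.
Qed.

Lemma is_smith_form_uniq p m (M : 'M[R]_(p, m)) s t :
  is_smith_form M s -> is_smith_form M t -> forall i, assoc s`_i t`_i.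
Proof.
move=> smith_s smith_t; have [_ _ cs es] := smith_s; have [_ _ ct et] := smith_t.
apply: diag_rect_equiv_assoc cs ct _; try exact: is_smith_form_size.
- exact: is_smith_form_size smith_s.
- exact: is_smith_form_size smith_t.
exact: mx_equiv_trans (mx_equiv_sym es) et.
Qed.

Lemma is_smith_form_assoc p m (M : 'M[R]_(p, m)) s t : size s = size t ->
  (forall i, assoc s`_i t`_i) -> is_smith_form M s -> is_smith_form M t.
Proof.
move=> sz st [rk nz cs eqM]; split; rewrite -?sz //.
- by move=> i lt_i; rewrite (assoc_neq0 (st i)) nz.
- exact: dvdr_chain_assoc cs.
move: eqM; rewrite !frac_diag_rect; apply: mx_equiv_diag_assoc => i.
rewrite !nth_map0 ?tofrac0 //; have [u Uu ->] := st i.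
by exists u; rewrite ?tofracM.
Qed.

Lemma smith_form_exists p m (M : 'M[R]_(p, m)) : elementary_divisor_domain R ->
  exists s, is_smith_form M s.
Proof.
move=> R_edd; have [U [V [s [[UU UV sz nz cs] E]]]] := smith_reduction R_edd M.
by exists s; apply: is_smith_formP => //; exact: mx_equiv_frac E.
Qed.

End Equivalence.

(** Finite choice, with the witnesses in a list; the default [x0] stays free so that each use can
    pick the padding it wants. *)
Lemma seq_choice (T : Type) (n : nat) (P : nat -> T -> Prop) :
  (forall i, (i < n)%N -> exists x, P i x) ->
  exists2 s : seq T, size s = n & forall x0 i, (i < n)%N -> P i (nth x0 s i).
Proof.
elim: n => [|n IHn] exP; first by exists [::].
have [s sz Ps] := IHn (fun i lt_i => exP i (ltnW lt_i)).
have [x Px] := exP n (ltnSn n).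
exists (rcons s x) => [|x0 i]; first by rewrite size_rcons sz.
rewrite ltnS nth_rcons sz leq_eqVlt => /predU1P[->|lt_i]; first by rewrite ltnn eqxx.
by rewrite lt_i; exact: Ps.
Qed.

(** * Coprime matrix pairs and coprime matrix fractions *)

Section Coprime.
Variable R : idomainType.
Hypothesis R_edd : elementary_divisor_domain R.

(** The Smith reduction writes the stacked matrix as a unimodular matrix times [T] over 0. Then [T]
    is a common right divisor of [A] and [C], hence unimodular, and can be divided out. *)
Lemma right_coprime_unimodular n q (A : 'M[R]_n) (C : 'M[R]_(q, n)) :
  right_coprime A C ->
  exists2 U : 'M[R]_(n + q), U \in unitmx & U *m col_mx A C = col_mx 1%:M 0.
Proof.
move=> coprime_AC.
have [U [V [s [[UU UV sz _ _] E]]]] := smith_reduction R_edd (col_mx A C).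
rewrite diag_rect_col in E; last by move: sz; rewrite leq_min => /andP[].
pose T := diag_rect n n s *m invmx V.
have UAC : U *m col_mx A C = col_mx T 0.
  by rewrite -[LHS](mulmxK UV) E mul_col_mx mul0mx.
have EAC : col_mx A C = lsubmx (invmx U) *m T.
  by rewrite -[LHS](mulKmx UU) UAC -{1}[invmx U]hsubmxK mul_row_col mulmx0 addr0.
have UT : T \in unitmx.
  apply: coprime_AC.
    by exists (usubmx (lsubmx (invmx U))); rewrite mul_usub_mx -EAC col_mxKu.
  by exists (dsubmx (lsubmx (invmx U))); rewrite mul_dsub_mx -EAC col_mxKd.
exists (block_mx (invmx T) 0 0 1%:M *m U).
  by rewrite unitmx_mul UU andbT unitmxE det_ublock unitrM -!unitmxE unitmx_inv UT unitmx1.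
by rewrite -mulmxA UAC mul_block_col !mulmx0 !mul0mx !addr0 mulVmx.
Qed.

(** Coprimeness of [N] and [Q] is delivered as a Bezout identity, the form in which
    [coprime_fraction_uniq] uses it. *)
Lemma right_fraction n m p (A : 'M[R]_n) (B : 'M[R]_(n, m)) (C : 'M[R]_(p, n))
    (D : 'M[R]_(p, m)) :
  \det A != 0 -> left_coprime A B -> right_coprime A C ->
  exists (N : 'M[R]_(p, m)) (Q : 'M[R]_m) (X : 'M[R]_(m, p)) (Y : 'M[R]_m),
  [/\ transfer_mx A B C D *m frac_mx Q = frac_mx N, X *m N + Y *m Q = 1%:M,
      mx_equiv (frac_mx (block_mx A B C D)) (frac_mx (block_mx 1%:M 0 0 N))
    & mx_equiv (frac_mx (block_mx A 0 0 (1%:M : 'M[R]_m)))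
               (frac_mx (block_mx 1%:M 0 0 Q))].
Proof.
move=> detA coprime_AB coprime_AC.
have [L UL EL] := right_coprime_unimodular coprime_AC.
have [W UW EW] := right_coprime_unimodular coprime_AB.
pose Z := W^T; have UZ : Z \in unitmx by rewrite unitmx_tr.
have ABZ : row_mx A B *m Z = row_mx 1%:M 0.
  by apply: trmx_inj; rewrite trmx_mul !tr_row_mx /Z trmxK EW trmx1 trmx0.
pose X := ulsubmx L; pose Y := ursubmx L.
have bezAC : X *m A + Y *m C = 1%:M.
  by rewrite -mul_row_col hsubmxK mul_usub_mx EL col_mxKu.
pose Z11 := ulsubmx Z; pose Z12 := ursubmx Z; pose Z21 := dlsubmx Z; pose Q := drsubmx Z.
have EZ : Z = block_mx Z11 Z12 Z21 Q by rewrite submxK.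
have [E11 E12] : A *m Z11 + B *m Z21 = 1%:M /\ A *m Z12 + B *m Q = 0.
  by apply: eq_row_mx; rewrite -mul_row_block -EZ.
pose K1 := dlsubmx (invmx Z); pose K2 := drsubmx (invmx Z).
have bezZ : K1 *m Z12 + K2 *m Q = 1%:M.
  have := mulVmx UZ; rewrite EZ -[invmx _]submxK mulmx_block -EZ scalar_mx_block.
  by case/eq_block_mx.
pose N := C *m Z12 + D *m Q.
(* Since [X A + Y C = 1], [A Z12 = - B Q] and [C Z12 = N - D Q], one has
   [Z12 = Y N - (X B + Y D) Q]; substituting this in [bezZ] gives the cofactors. *)
exists N, Q, (K1 *m Y), (K2 - K1 *m (X *m B + Y *m D)); split.
- have UA := frac_mx_det detA.
  have BQ : frac_mx B *m frac_mx Q = - (frac_mx A *m frac_mx Z12).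
    apply/eqP; rewrite -addr_eq0 addrC -!frac_mxM -map_mxD E12.
    by rewrite map_mx0.
  rewrite /transfer_mx mulmxBl -!mulmxA BQ !mulmxN opprK mulKmx //.
  by rewrite addrC -!frac_mxM -map_mxD.
- have AZ : A *m Z12 = - (B *m Q) by apply/eqP; rewrite -addr_eq0 E12.
  have EZ12 : Z12 = Y *m C *m Z12 - X *m B *m Q.
    by rewrite -{1}[Z12]mul1mx -bezAC mulmxDl -mulmxA AZ mulmxN addrC mulmxA.
  rewrite -bezZ [in X in _ = X + _]EZ12 /N !mulmxBl mulmxBr !mulmxDr mulmxDl !mulmxA.
  by rewrite [K1 *m X *m B *m Q + _]addrC opprD addrCA [_ + (- _ - _)]addrA addrK addrC.
(* Multiplying by [Z] turns the upper block row into [1 0] and puts [N] in the lower right corner;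
   the left factor clears the lower left block. *)
- apply: (@mx_equiv_frac _ _ _ _ _ (block_mx 1%:M 0 (- (C *m Z11 + D *m Z21)) 1%:M) Z) => //.
    by rewrite unitmxE det_lblock !det1 mulr1 unitr1.
  rewrite -mulmxA [in X in _ *m X]EZ mulmx_block E11 E12 mulmx_block.
  by rewrite !(mul1mx, mulmx1, mul0mx, mulmx0, addr0, add0r) addNr.
(* The factor containing [B] turns the upper block row into [A B], so multiplying by [Z] leaves the
   block rows [1 0] and [Z21 Q]; then [Z21] is cleared. *)
- apply: (@mx_equiv_frac _ _ _ _ _ (block_mx 1%:M 0 (- Z21) 1%:M *m block_mx 1%:M B 0 1%:M) Z) => //.
    by rewrite unitmx_mul !unitmxE det_lblock det_ublock !det1 mulr1 unitr1.
  rewrite -!mulmxA [block_mx _ B _ _ *m _]mulmxA mulmx_block.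
  rewrite !(mul1mx, mulmx1, mul0mx, mulmx0, addr0, add0r) EZ mulmx_block E11 E12 mulmx_block.
  by rewrite !(mul1mx, mulmx1, mul0mx, mulmx0, addr0, add0r) addNr.
Qed.

(* [HS] below is [S^-1], so [W = S^-1 Q]; the Bezout identities show that [W] and
   its inverse have entries in [R]. *)
Lemma coprime_fraction_uniq p m (G : 'M[{fraction R}]_(p, m)) (N E : 'M[R]_(p, m))
    (Q S : 'M[R]_m) (X X' : 'M[R]_(m, p)) (Y Y' : 'M[R]_m) :
  G *m frac_mx Q = frac_mx N -> G *m frac_mx S = frac_mx E ->
  X *m N + Y *m Q = 1%:M -> X' *m E + Y' *m S = 1%:M ->
  exists2 W : 'M[R]_m, W \in unitmx & N = E *m W /\ Q = S *m W.
Proof.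
move=> GQ GS bezQ bezS.
pose HQ := frac_mx X *m G + frac_mx Y; pose HS := frac_mx X' *m G + frac_mx Y'.
have HQQ : HQ *m frac_mx Q = 1%:M.
  by rewrite mulmxDl -mulmxA GQ -!frac_mxM -map_mxD bezQ map_mx1.
have HSS : HS *m frac_mx S = 1%:M.
  by rewrite mulmxDl -mulmxA GS -!frac_mxM -map_mxD bezS map_mx1.
have EW : frac_mx (X' *m N + Y' *m Q) = HS *m frac_mx Q.
  by rewrite mulmxDl -mulmxA GQ -!frac_mxM -map_mxD.
have EW' : frac_mx (X *m E + Y *m S) = HQ *m frac_mx S.
  by rewrite mulmxDl -mulmxA GS -!frac_mxM -map_mxD.
exists (X' *m N + Y' *m Q); last first.
  split; apply: frac_mx_inj; rewrite frac_mxM EW.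
    by rewrite -GS -mulmxA [frac_mx S *m _]mulmxA (mulmx1C HSS) mul1mx.
  by rewrite mulmxA (mulmx1C HSS) mul1mx.
suff /mulmx1_unit[] : (X' *m N + Y' *m Q) *m (X *m E + Y *m S) = 1%:M by [].
apply: frac_mx_inj; rewrite frac_mxM EW EW' mulmxA -[HS *m _ *m _]mulmxA.
by rewrite (mulmx1C HQQ) mulmx1 HSS frac_mx1.
Qed.

End Coprime.

(** * Smith-McMillan forms: consequences, existence, change by units *)

Section SmithMcMillan.
Variable R : idomainType.
Hypothesis R_edd : elementary_divisor_domain R.

Lemma nth_quotients (eps psi : seq R) i : size eps = size psi ->
  (quotients eps psi)`_i = (eps`_i)%:F / (psi`_i)%:F.
Proof.
move=> sz; rewrite /quotients; have [lt_i|le_i] := ltnP i (size eps).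
  by rewrite (nth_map (0, 0)) ?size_zip -?sz ?minnn // nth_zip.
(* Past the end both sides are 0, the right one being [0 / 0]. *)
rewrite nth_default; last by rewrite size_map size_zip -sz minnn.
by rewrite nth_default // tofrac0 mul0r.
Qed.

Lemma smith_mcmillan_bezout p m (eps psi : seq R) : size eps = size psi ->
  (size eps <= minn p m)%N -> (forall i, (i < size eps)%N -> is_gcd 1 [:: eps`_i; psi`_i]) ->
  exists (X : 'M[R]_(m, p)) Y, X *m diag_rect p m eps +
    Y *m diag_rect m m (psi ++ nseq (m - size psi) 1) = 1%:M.
Proof.
move=> sz; rewrite leq_min => /andP[le_rp le_rm] gcd1.
have [xy sz_xy bez] : exists2 xy : seq (R * R), size xy = size eps &
    forall z i, (i < size eps)%N -> (nth z xy i).1 * eps`_i + (nth z xy i).2 * psi`_i = 1.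
  apply: seq_choice (fun i z => z.1 * eps`_i + z.2 * psi`_i = 1) _ => i lt_i.
  by have [x [y bez]] := gcd1_bezout R_edd (gcd1 i lt_i); exists (x, y).
(* The default [(0, 1)] solves the identity past the end of [eps], where the numerator is 0 and the
   padded denominator is 1. *)
pose x i := (nth (0, 1) xy i).1; pose y i := (nth (0, 1) xy i).2.
have bez_xy i : (i < size eps)%N -> x i * eps`_i + y i * psi`_i = 1 by exact: bez.
have y1 i : (size eps <= i)%N -> y i = 1 by move=> le_i; rewrite /y nth_default ?sz_xy.
exists (diag_rect m p (mkseq x p)), (diag_rect m m (mkseq y m)).
rewrite (@mul_diag_rect _ _ _ _ _ _ (mkseq (fun i => x i * eps`_i) m)); last first.
  move=> i lt_i _; rewrite nth_mkseq //; case: ltnP => [lt_ip|le_pi].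
    by rewrite nth_mkseq.
  by rewrite [eps`_i]nth_default ?mulr0 // (leq_trans le_rp).
rewrite (@mul_diag_rect _ _ _ _ _ _
  (mkseq (fun i => y i * (psi ++ nseq (m - size psi) 1)`_i) m)); last first.
  by move=> i lt_i _; rewrite lt_i !nth_mkseq.
apply/matrixP=> i j; rewrite !mxE -[i == j]val_eqE.
case: eqP => [eq_ij|_]; last by rewrite addr0.
rewrite !nth_mkseq // nth_cat -sz; case: ltnP => [lt_i|le_i]; first exact: bez_xy.
by rewrite y1 // nth_nseq ltn_sub2r ?(leq_ltn_trans le_i) // [eps`_i]nth_default // mulr0 add0r mulr1.
Qed.

(** [A] and the denominator [Q] have different sizes, so the comparison yields [A] only up to an
    added identity block; [state_smith_form] removes it. *)
Lemma system_smith_forms n m p (A : 'M[R]_n) (B : 'M[R]_(n, m)) (C : 'M[R]_(p, n))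
    (D : 'M[R]_(p, m)) eps psi :
  \det A != 0 -> left_coprime A B -> right_coprime A C ->
  is_smith_mcmillan_form (transfer_mx A B C D) eps psi ->
  is_smith_form (block_mx A B C D) (nseq n 1 ++ eps) /\
  mx_equiv (frac_mx (block_mx A 0 0 (1%:M : 'M[R]_m)))
    (frac_mx (diag_rect (n + m) (n + m) (nseq n 1 ++ psi ++ nseq (m - size psi) 1))).
Proof.
move=> detA coprime_AB coprime_AC [[sz_eps sz_psi] nz [chain_eps _] gcd1 [U [V [UU UV EG]]]].
have [N [Q [X [Y [GQ bez eqP eqA]]]]] := right_fraction R_edd D detA coprime_AB coprime_AC.
set G := transfer_mx A B C D in sz_eps sz_psi nz gcd1 EG GQ.
have sz : size eps = size psi by rewrite sz_eps.
have le_r : (size eps <= minn p m)%N by rewrite sz_eps leq_min rank_leq_row rank_leq_col.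
have gcd1' i : (i < size eps)%N -> is_gcd 1 [:: eps`_i; psi`_i] by rewrite sz_eps; exact: gcd1.
have [X' [Y' bez']] := smith_mcmillan_bezout sz le_r gcd1'.
pose E := diag_rect p m eps; pose S := diag_rect m m (psi ++ nseq (m - size psi) 1).
(* Both fractions are taken for [U G V]: one is [(U N) (V^-1 Q)^-1], the other [E S^-1]. *)
have [W UW [EN EQ]] : exists2 W : 'M[R]_m, W \in unitmx & U *m N = E *m W /\ invmx V *m Q = S *m W.
  apply: (@coprime_fraction_uniq _ _ _ (frac_mx U *m G *m frac_mx V) _ _ _ _ (X *m invmx U) X' (Y *m V) Y') => //.
  - by rewrite -!mulmxA -frac_mxM mulKVmx // GQ frac_mxM.
  - rewrite EG !frac_diag_rect; apply: mul_diag_rect => i lt_ip lt_im.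
    rewrite lt_im nth_quotients // !nth_map0 ?tofrac0 // nth_cat -sz.
    case: ltnP => [lt_i|le_i]; last by rewrite [eps`_i]nth_default // tofrac0 !mul0r.
    by rewrite divfK // tofrac_eq0; case: (nz i); rewrite -?sz_eps.
  - by rewrite !mulmxA mulmxKV // mulmxK.
have eqN : mx_equiv (frac_mx N) (frac_mx E).
  apply: (@mx_equiv_frac _ _ _ _ _ U (invmx W)); rewrite ?unitmx_inv //.
  by rewrite EN mulmxK.
have eqQ : mx_equiv (frac_mx Q) (frac_mx S).
  apply: (@mx_equiv_frac _ _ _ _ _ (invmx V) (invmx W)); rewrite ?unitmx_inv //.
  by rewrite EQ mulmxK.
have eq1 : mx_equiv (frac_mx (1%:M : 'M[R]_n)) (frac_mx (diag_rect n n (nseq n 1))).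
  by rewrite diag_rect_ones; exact: mx_equiv_refl.
split; last first.
  rewrite diag_rect_cat ?size_nseq //; apply: mx_equiv_trans eqA _; exact: mx_equiv_block.
apply: is_smith_formP.
- by rewrite size_cat size_nseq -addn_minr leq_add2l.
- move=> i; rewrite size_cat size_nseq nth_cat size_nseq nth_nseq => lt_i.
  case: ltnP => [_|le_ni]; first exact: oner_neq0.
  by case: (nz (i - n)%N) => //; rewrite -sz_eps ltn_subLR.
- exact: dvdr_chain_ones.
rewrite diag_rect_cat ?size_nseq //; apply: mx_equiv_trans eqP _; exact: mx_equiv_block.
Qed.

Local Open Scope quotient_scope.

Lemma fraction_denom (x : {fraction R}) : exists n d : R, d != 0 /\ d%:F * x = n%:F.
Proof.
elim/quotW: x => x; exists \n_x, \d_x; split; first exact: denom_ratioP.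
rewrite -[_ * _]/(FracField.mul _ _) !piE.
apply/eqmodP; rewrite /= FracField.equivfE /FracField.mulf.
by rewrite !numden_Ratio ?mulr1 ?mul1r ?oner_eq0 ?denom_ratioP // mulrC.
Qed.

Lemma common_denom p m (G : 'M[{fraction R}]_(p, m)) :
  exists2 d : R, d != 0 & exists M : 'M[R]_(p, m), frac_mx M = d%:F *: G.
Proof.
have /fin_all_exists[f Ef] : forall ij : 'I_p * 'I_m, exists nd : R * R,
    nd.2 != 0 /\ nd.2%:F * G ij.1 ij.2 = nd.1%:F.
  by move=> ij; have [n [d nd]] := fraction_denom (G ij.1 ij.2); exists (n, d).
exists (\prod_ij (f ij).2); first by apply/prodf_neq0 => ij _; case: (Ef ij).
exists (\matrix_(i, j) (\prod_(kl | kl != (i, j)) (f kl).2 * (f (i, j)).1)).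
apply/matrixP=> i j; rewrite !mxE [in RHS](bigD1 (i, j)) // !tofracM.
by have [_ <-] := Ef (i, j); rewrite /= mulrA [_ * (f (i, j)).2%:F]mulrC.
Qed.

(** With [G = M / d] and [s] the diagonal of a Smith reduction of [M], the fractions [s_i / d] are
    put in lowest terms [e_i / h_i]. The chain of [s] passes to [e] and, reversed, to [h] by Gauss's
    lemma. *)
Lemma smith_mcmillan_form_exists p m (G : 'M[{fraction R}]_(p, m)) :
  exists eps psi, is_smith_mcmillan_form G eps psi.
Proof.
have [d nz_d [M EM]] := common_denom G.
have [U [V [s [[UU UV sz nz_s chain_s] E]]]] := smith_reduction R_edd M.
have nz_dF : d%:F != 0 :> {fraction R} by rewrite tofrac_eq0.
have rkG : \rank G = size s.
  rewrite -(eqmx_scale G nz_dF) -EM (mx_equiv_rank (mx_equiv_frac UU UV E)).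
  rewrite frac_diag_rect rank_diag_rect ?size_map // => i lt_i.
  by rewrite (nth_map 0) // tofrac_eq0 nz_s.
have [f sz_f Ef] : exists2 f : seq (R * R), size f = size s & forall z i, (i < size s)%N ->
    exists g x y, [/\ s`_i = (nth z f i).1 * g, d = (nth z f i).2 * g &
                      x * (nth z f i).1 + y * (nth z f i).2 = 1].
  apply: seq_choice (fun i z => exists g x y,
    [/\ s`_i = z.1 * g, d = z.2 * g & x * z.1 + y * z.2 = 1]) _ => i _.
  have [g [e [h [x [y [Es Ed bez]]]]]] := edd_bezout R_edd s`_i d.
  by exists (e, h), g, x, y.
pose e := [seq z.1 | z <- f]; pose h := [seq z.2 | z <- f].
have sz_e : size e = size s by rewrite size_map.
have sz_h : size h = size s by rewrite size_map.
have eh i : (i < size s)%N -> exists g x y,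
    [/\ s`_i = e`_i * g, d = h`_i * g & x * e`_i + y * h`_i = 1].
  by move=> lt_i; rewrite !(nth_map (0, 0)) ?sz_f //; exact: Ef.
have nz i : (i < size s)%N -> e`_i != 0 /\ h`_i != 0.
  move=> lt_i; have [g [x [y [Es Ed _]]]] := eh i lt_i.
  split; first by apply: contraNneq (nz_s i lt_i) => e0; rewrite Es e0 mul0r.
  by apply: contraNneq nz_d => h0; rewrite Ed h0 mul0r.
have gcd1 i : (i < size s)%N -> is_gcd 1 [:: e`_i; h`_i].
  by move=> lt_i; have [g [x [y [_ _ bez]]]] := eh i lt_i; exact: is_gcd1_bezout bez.
have cross i : (i < size s)%N -> s`_i * h`_i = d * e`_i.
  by move=> lt_i; have [g [x [y [-> -> _]]]] := eh i lt_i; rewrite mulrC mulrAC mulrA.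
(* This is [s_(i+1) = c s_i] rewritten through [cross], with [d] cancelled. Coprimeness of [e_i] and
   [h_i] then gives the first chain, that of [e_(i+1)] and [h_(i+1)] the second. *)
have step i : (i.+1 < size s)%N -> exists c, e`_i.+1 * h`_i = c * e`_i * h`_i.+1.
  move=> lt_i; have [c Ec] := chain_s i lt_i; exists c; apply: (mulfI nz_d).
  rewrite mulrA -cross // Ec [in RHS]mulrA [d * (c * _)]mulrCA -cross; last exact: ltnW.
  by rewrite mulrA [LHS]mulrAC.
exists e, h; rewrite /is_smith_mcmillan_form rkG; split=> //.
  split=> i; rewrite ?size_rev ?sz_e ?sz_h => lt_i.
    have [c Ec] := step i lt_i.
    apply: (gauss_dvdr R_edd (gcd1 i (ltnW lt_i))).
    by rewrite mulrC Ec mulrAC; exists (c * h`_i.+1).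
  rewrite !nth_rev ?sz_h //; last exact: ltnW.
  (* Positions [i] and [i.+1] of the reversed list hold [h_(j+1)] and [h_j]. *)
  set j := (size s - i.+2)%N; have -> : (size s - i.+1 = j.+1)%N by rewrite subnSK.
  have lt_j : (j.+1 < size s)%N by rewrite /j -subSn // ltn_subLR; lia.
  have [c Ec] := step j lt_j; apply: (gauss_dvdr R_edd (b := e`_j.+1)).
    have [g [x [y [_ _ bez]]]] := eh _ lt_j.
    by apply: (@is_gcd1_bezout _ _ _ y x); rewrite addrC.
  by rewrite Ec; exists (c * e`_j).
exists U, V; split=> //.
have -> : G = (d%:F)^-1 *: frac_mx M by rewrite EM scalerA mulVf // scale1r.
rewrite -scalemxAr -scalemxAl -!frac_mxM E frac_diag_rect.
apply/matrixP=> i j; rewrite !mxE; case: eqP => [_|_]; last by rewrite mulr0.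
rewrite nth_quotients ?sz_e // nth_map0 ?tofrac0 //.
have [lt_i|le_i] := ltnP i (size s); last first.
  by rewrite [s`_i]nth_default ?[e`_i]nth_default ?sz_e // tofrac0 mulr0 mul0r.
have [_ nz_h] := nz _ lt_i; apply: (mulfI nz_dF); rewrite mulrA mulfV // mul1r.
by rewrite mulrA -tofracM -cross // tofracM mulfK // tofrac_eq0.
Qed.

Lemma is_smith_mcmillan_form_assoc p m (G : 'M[{fraction R}]_(p, m)) eps psi eps' psi' :
  size eps' = size eps -> size psi' = size psi ->
  (forall i, assoc eps`_i eps'`_i) -> (forall i, (i < size psi)%N -> assoc psi`_i psi'`_i) ->
  is_smith_mcmillan_form G eps psi -> is_smith_mcmillan_form G eps' psi'.
Proof.
move=> sz_e sz_p ass_e ass_p [[rk_e rk_p] nz [chain_e chain_p] gcd1 eqG].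
split; rewrite ?sz_e ?sz_p //.
- move=> i lt_i; have [nze nzp] := nz i lt_i.
  by rewrite (assoc_neq0 (ass_e i)) (assoc_neq0 (ass_p _ _)) ?rk_p.
- split; first exact: dvdr_chain_assoc chain_e.
  apply: dvdr_chain_assoc chain_p; first by rewrite !size_rev.
  move=> i; rewrite size_rev => lt_i; rewrite !nth_rev ?sz_p //.
  by apply: ass_p; rewrite subnS prednK ?subn_gt0 ?leq_subr.
- move=> i lt_i; apply: is_gcd_assoc (gcd1 i lt_i) _ _ (ass_e i) _.
  by apply: ass_p; rewrite rk_p.
apply: mx_equiv_diag_assoc eqG => i; rewrite !nth_quotients ?sz_e ?sz_p ?rk_e ?rk_p //.
have [u Uu ->] := ass_e i; have [lt_i|le_i] := ltnP i (size psi); last first.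
  exists 1; first exact: unitr1.
  by rewrite !(@nth_default _ 0 eps) ?mulr0 ?tofrac0 ?mul0r ?mulr0 // rk_e -rk_p.
have [v Uv ->] := ass_p i lt_i; exists (u / v); first by rewrite unitrM unitrV Uu Uv.
by rewrite !tofracM rmorphV // invfM mulrACA.
Qed.

End SmithMcMillan.

(** * The Smith form of the state matrix [A] *)

Section StateMatrix.
Variable R : idomainType.
Hypothesis R_edd : elementary_divisor_domain R.

Lemma last_nonunit_size (psi : seq R) : (last_nonunit psi <= size psi)%N.
Proof. by apply/bigmax_leqP => i _. Qed.

Lemma last_nonunit_unit (psi : seq R) i :
  (last_nonunit psi <= i)%N -> (i < size psi)%N -> psi`_i \is a GRing.unit.
Proof.
move=> le_gi lt_i; apply: contraLR le_gi => nonunit; rewrite -ltnNge.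
exact: (@leq_bigmax_cond _ (fun j : 'I_(size psi) => psi`_j \isn't a GRing.unit)
  (fun j => j.+1) (Ordinal lt_i)).
Qed.

(** The property is vacuous at 0, true of each index that enters the maximum, and stable under
    [maxn]. *)
Lemma last_nonunitP (psi : seq R) :
  (0 < last_nonunit psi)%N -> psi`_(last_nonunit psi).-1 \isn't a GRing.unit.
Proof.
rewrite /last_nonunit; elim/big_ind: _ => // x y Px Py.
by rewrite /maxn; case: (ltnP x y).
Qed.

(** Counted from the far end, the leading ones are the default value 1 past the end of [s]. *)
Lemma nth_ones_rev k r (s : seq R) i : size s = r -> (i < k + r)%N ->
  (nseq k 1 ++ rev s)`_i = nth 1 s (k + r - i.+1).
Proof.
move=> sz lt_i; rewrite nth_cat size_nseq nth_nseq; case: ltnP => [lt_ik|le_ki].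
  by rewrite nth_default ?sz //; lia.
rewrite nth_rev ?sz; last by lia.
rewrite [LHS](set_nth_default 1) ?sz; last by lia.
by congr nth; lia.
Qed.

(** Up to order, the sum of [A] and an identity block has two diagonal forms, ones followed by the
    invariant factors [alpha] of [A] and ones followed by [rev psi]. Both are chains of equal
    length, so they agree entrywise up to units. *)
Lemma state_smith_form n m (A : 'M[R]_n) (psi : seq R) :
  \det A != 0 -> (size psi <= m)%N -> dvdr_chain (rev psi) ->
  mx_equiv (frac_mx (block_mx A 0 0 (1%:M : 'M[R]_m)))
    (frac_mx (diag_rect (n + m) (n + m) (nseq n 1 ++ psi ++ nseq (m - size psi) 1))) ->
  let g := last_nonunit psi in
  (g <= n)%N /\ is_smith_form A (nseq (n - g) 1 ++ rev (take g psi)).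
Proof.
move=> detA le_rm chain_psi eqA g.
have [alpha smith_A] := smith_form_exists A R_edd.
have [sz_alpha _ chain_alpha eq_alpha] := smith_A.
have {}sz_alpha : size alpha = n by rewrite sz_alpha mxrank_unit // frac_mx_det.
set r := size psi in le_rm eqA *.
have le_gr : (g <= r)%N := last_nonunit_size psi.
have eq1 : mx_equiv (frac_mx (1%:M : 'M[R]_m)) (frac_mx (diag_rect m m (nseq m 1))).
  by rewrite diag_rect_ones; exact: mx_equiv_refl.
have eqL : mx_equiv (frac_mx (block_mx A 0 0 (1%:M : 'M[R]_m)))
                    (frac_mx (diag_rect (n + m) (n + m) (nseq m 1 ++ alpha))).
  apply: mx_equiv_trans (mx_equiv_block eq_alpha eq1) _.
  rewrite -diag_rect_cat //; apply: mx_equiv_perm; last by rewrite perm_catC.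
  by rewrite size_cat size_nseq sz_alpha.
have eqT : mx_equiv (frac_mx (block_mx A 0 0 (1%:M : 'M[R]_m)))
                    (frac_mx (diag_rect (n + m) (n + m) (nseq (n + (m - r)) 1 ++ rev psi))).
  apply: mx_equiv_trans eqA _; apply: mx_equiv_perm.
    by rewrite !size_cat !size_nseq -/r subnKC.
  rewrite nseqD -catA perm_cat2l perm_catC perm_cat2l.
  by rewrite perm_sym perm_rev.
have ass i : assoc (nseq m 1 ++ alpha)`_i (nseq (n + (m - r)) 1 ++ rev psi)`_i.
  apply: (@diag_rect_equiv_assoc _ (n + m) (n + m)).
  - by rewrite minnn size_cat size_nseq sz_alpha addnC.
  - by rewrite minnn size_cat size_nseq size_rev -/r; lia.
  - exact: dvdr_chain_ones.
  - exact: dvdr_chain_ones.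
  - exact: mx_equiv_trans (mx_equiv_sym eqL) eqT.
have le_gn : (g <= n)%N.
  rewrite leqNgt; apply/negP=> lt_ng.
  have g_gt0 : (0 < g)%N by lia.
  (* If [n < g], this position falls among the [m] leading ones of the first list, while the second
     list holds there the last nonunit of [psi]. *)
  have := ass (n + m - g)%N; rewrite nth_cat size_nseq nth_nseq (nth_ones_rev (r := r)) //; last by lia.
  have -> : (n + m - g < m)%N by lia.
  have -> : (n + (m - r) + r - (n + m - g).+1 = g.-1)%N by lia.
  move/assoc_unit; rewrite unitr1 (set_nth_default 0); last by rewrite prednK.
  by rewrite (negPf (last_nonunitP g_gt0)).
split=> //; apply: is_smith_form_assoc smith_A.
  by rewrite size_cat size_nseq size_rev size_takel // subnK.
move=> i; have [lt_in|le_ni] := ltnP i n; last first.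
  rewrite !nth_default ?sz_alpha //; first exact: assoc_refl.
  by rewrite size_cat size_nseq size_rev size_takel // subnK.
(* Skipping the [m] ones pairs [alpha_i] with the entry of [psi] at [n - i.+1], read as 1 past the
   end. *)
have := ass (m + i)%N; rewrite nth_cat size_nseq ltnNge leq_addr addKn /=.
rewrite (nth_ones_rev (r := r)) //; last by lia.
have -> : (n + (m - r) + r - (m + i).+1 = n - i.+1)%N by lia.
move/assoc_trans; apply; rewrite (nth_ones_rev (r := g)) ?size_takel ?subnK //.
(* From [g] on, [psi] has only units, so truncating to [take g psi] and reading 1 changes nothing up
   to units. *)
have [lt_g|le_g] := ltnP (n - i.+1) g; first by rewrite nth_take //; exact: assoc_refl.
rewrite [nth 1 (take _ _) _]nth_default ?size_takel //.
apply: unit_assoc; last exact: unitr1.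
have [lt_r|le_r] := ltnP (n - i.+1) r; last by rewrite nth_default // unitr1.
by rewrite (set_nth_default 0) // last_nonunit_unit.
Qed.

End StateMatrix.

(** * The correspondence between the forms of [A], [P] and [G] in both directions *)

Theorem theorem3p5 (R : idomainType)
    (R_edd : elementary_divisor_domain R) (R_not_field : ~ GRing.field_axiom R)
    (n m p : nat)
    (A : 'M[R]_n) (B : 'M[R]_(n, m)) (C : 'M[R]_(p, n)) (D : 'M[R]_(p, m))
    (detA : \det A != 0)
    (AB_coprime : left_coprime A B) (AC_coprime : right_coprime A C) :
  let P : 'M[R]_(n + p, n + m) := block_mx A B C D in
  let G : 'M[{fraction R}]_(p, m) := transfer_mx A B C D in
  let r := \rank G in
  (forall eps psi : seq R,
     is_smith_mcmillan_form G eps psi ->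
     let g := last_nonunit psi in
     is_smith_form P (nseq n 1 ++ eps) /\
     ((g <= n)%N /\ is_smith_form A (nseq (n - g) 1 ++ rev (take g psi))))
  /\
  (forall psi eps : seq R,
     size psi = n -> is_smith_form A (rev psi) ->
     size eps = (n + r)%N -> is_smith_form P eps ->
     [/\ forall i, (i < n)%N -> eps`_i \is a GRing.unit,
         (r <= n)%N ->
           forall i, (r <= i < n)%N -> psi`_i \is a GRing.unit
       & forall u : seq R, size u = (r - n)%N ->
           (forall i, (i < r - n)%N -> u`_i \is a GRing.unit) ->
           is_smith_mcmillan_form G (drop n eps) (take r (psi ++ u))]).
Proof.
move=> P G r.
have part1 eps psi : is_smith_mcmillan_form G eps psi -> let g := last_nonunit psi in
    is_smith_form P (nseq n 1 ++ eps) /\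
    ((g <= n)%N /\ is_smith_form A (nseq (n - g) 1 ++ rev (take g psi))).
  move=> smG; have [smP eqA] := system_smith_forms R_edd detA AB_coprime AC_coprime smG.
  split=> //; case: smG => -[_ sz_psi] _ [_ chain_psi] _ _.
  by apply: state_smith_form eqA => //; rewrite sz_psi rank_leq_col.
split=> // psi eps sz_psi smA sz_eps smP.
have [e [f smG]] := smith_mcmillan_form_exists R_edd G.
have [smP' [le_gn smA']] := part1 e f smG; set g := last_nonunit f in le_gn smA'.
have [[sz_e sz_f] _ _ _ _] := smG; rewrite -/r in sz_e sz_f.
have le_gr : (g <= r)%N by rewrite -sz_f last_nonunit_size.
have ass_eps i := is_smith_form_uniq smP' smP i.
(* Both Smith forms of [A] list the denominators backwards, hence the position [n - i.+1]; the
   default 1 stands for the leading ones. *)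
have ass_psi i : (i < n)%N -> assoc (nth 1 (take g f) i) psi`_i.
  move=> lt_in; have := is_smith_form_uniq smA' smA (n - i.+1)%N.
  rewrite (nth_ones_rev (r := g)) ?size_takel ?sz_f ?subnK // ?nth_rev ?sz_psi; try lia.
  by have -> : (n - (n - i.+1).+1 = i)%N by lia.
have unit_psi i : (g <= i < n)%N -> psi`_i \is a GRing.unit.
  case/andP=> le_gi lt_in; rewrite (assoc_unit (ass_psi i lt_in)) nth_default ?unitr1 //.
  by rewrite size_takel ?sz_f.
split.
- move=> i lt_in; rewrite (assoc_unit (ass_eps i)) nth_cat size_nseq nth_nseq lt_in.
  exact: unitr1.
- by move=> _ i /andP[le_ri lt_in]; rewrite unit_psi // (leq_trans le_gr).
(* The form [e, f] is transported entrywise. Denominators before [g] match by [ass_psi]; from [g] on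
   those of [f] are units, and so are those of [psi] and, past [n], of [u]. *)
move=> u sz_u unit_u; apply: is_smith_mcmillan_form_assoc smG.
- by rewrite size_drop sz_eps addKn sz_e.
- by rewrite size_takel ?sz_f // size_cat sz_psi sz_u; lia.
- move=> i; rewrite nth_drop; have := ass_eps (n + i)%N.
  by rewrite nth_cat size_nseq ltnNge leq_addr addKn.
move=> i; rewrite sz_f => lt_ir; rewrite nth_take // nth_cat sz_psi.
have [lt_ig|le_gi] := ltnP i g.
  have lt_in : (i < n)%N by exact: leq_trans le_gn.
  have := ass_psi i lt_in; rewrite lt_in (set_nth_default 0) ?nth_take //.
  by rewrite size_takel ?sz_f.
apply: unit_assoc; first by rewrite last_nonunit_unit // sz_f.
case: ltnP => [lt_in|le_ni]; first by rewrite unit_psi // le_gi.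
by apply: unit_u; lia.
Qed.
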